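(* Let $n\geq2$ be even. Then: (a) $G_n$ is an Abelian monoid with respect to composition of functions, and the map $\varphi:G_n\to\mathcal{M}_n$, $\varphi\big(\sum_{i=0}^{t}a_i\gamma_{2i}\big)=\big[\sum_{i=0}^{t}a_iX^i\big]$, is a monoid isomorphism (with $\mathcal{M}_n$ a monoid under multiplication in $\mathcal{R}_n$). In particular $G_n\cong\mathcal{M}_n$. (b) The set $G_n^*$ of invertible (equivalently, bijective) functions in $G_n$ is an Abelian group under composition, isomorphic to the unit group $\mathcal{R}_n^*=\mathcal{M}_n^*$ of $\mathcal{R}_n$.
   Context: Let $\mathbbm{1}=(1,\dots,1)\in\mathbb{F}_2^n$, let $\odot$ denote component-wise multiplication in $\mathbb{F}_2^n$, and let $S(x_1,\dots,x_n)=(x_2,\dots,x_n,x_1)$. Define $\gamma_0=\mathrm{id}$ and, for $k\geq1$, $\gamma_{2k}(x)=S^{2k}(x)\odot(\mathbbm{1}+S^{2k-1}(x))\odot(\mathbbm{1}+S^{2k-3}(x))\odot\cdots\odot(\mathbbm{1}+S(x))$, as functions $\mathbb{F}_2^n\to\mathbb{F}_2^n$. Let $\Gamma_n$ be the $\mathbb{F}_2$-span of all $\gamma_{2k}$, $k\ge 0$ (functions added pointwise); for even $n$ it has basis $\gamma_0,\gamma_2,\dots,\gamma_{2n-2}$. Let $G_n=\gamma_0+\mathrm{span}_{\mathbb{F}_2}\{\gamma_2,\gamma_4,\dots,\gamma_{2n-2}\}$. Let $\mathcal{R}_n=\mathbb{F}_2[X]/(X^n+X^{n/2})$, with $[f]$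 the class of $f\in\mathbb{F}_2[X]$, and let $\mathcal{M}_n=\{[1+\sum_{i=1}^ta_iX^i]: t\geq1, a_i\in\mathbb{F}_2\}\subseteq\mathcal{R}_n$. The map $\varphi:\Gamma_n\to\mathcal{R}_n$, $\sum_i a_i\gamma_{2i}\mapsto[\sum_i a_iX^i]$, is a well-defined bijection. *)

(* Defs.v *)
From HB Require Import structures.
From mathcomp Require Import all_boot all_order all_algebra.

Set Implicit Arguments.
Unset Strict Implicit.
Unset Printing Implicit Defensive.

Import GRing.Theory.
Local Open Scope ring_scope.

Section MonoidsOnSubsets.

Variables (T U : Type).

Record abelian_monoid (A : T -> Prop) (op : T -> T -> T) (e : T) : Prop := {
  abm_unit : A e;
  abm_closed : forall x y, A x -> A y -> A (op x y);
  abm_assoc : forall x y z, A x -> A y -> A z -> op x (op y z) = op (op x y) z;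
  abm_unitl : forall x, A x -> op e x = x;
  abm_unitr : forall x, A x -> op x e = x;
  abm_comm : forall x y, A x -> A y -> op x y = op y x
}.

Definition invertible (A : T -> Prop) (op : T -> T -> T) (e x : T) : Prop :=
  A x /\ exists y, [/\ A y, op x y = e & op y x = e].

Definition abelian_group (A : T -> Prop) (op : T -> T -> T) (e : T) : Prop :=
  abelian_monoid A op e /\ forall x, A x -> invertible A op e x.

Record monoid_iso (A : T -> Prop) (opA : T -> T -> T) (eA : T)
    (B : U -> Prop) (opB : U -> U -> U) (eB : U) (f : T -> U) : Prop := {
  iso_into : forall x, A x -> B (f x);
  iso_inj : forall x y, A x -> A y -> f x = f y -> x = y;
  iso_surj : forall z, B z -> exists2 x, A x & f x = z;
  iso_unit : f eA = eB;
  iso_mul : forall x y, A x -> A y -> f (opA x y) = opB (f x) (f y)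
}.

Definition monoid_isomorphic (A : T -> Prop) (opA : T -> T -> T) (eA : T)
    (B : U -> Prop) (opB : U -> U -> U) (eB : U) : Prop :=
  exists f : T -> U, monoid_iso A opA eA B opB eB f.

End MonoidsOnSubsets.

Notation vec n := 'rV['F_2]_n.
Notation vecfun n := {ffun vec n -> vec n}.

Definition idfun_ff (n : nat) : vecfun n := [ffun x => x].
Definition comp_ff (n : nat) (f g : vecfun n) : vecfun n := [ffun x => f (g x)].

Section Gamma.

Variable n : nat.

Definition ones : vec n := const_mx 1.
Definition hmul (x y : vec n) : vec n := map2_mx *%R x y.

(* [ordS i] has value [i.+1 %% n], so this is (x_2, ..., x_n, x_1). *)
Definition shift (x : vec n) : vec n := \row_i x ord0 (ordS i).

(* [gamma k] is the function written gamma_{2k}; see [gamma0] for k = 0. *)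
Definition gamma (k : nat) : vecfun n :=
  [ffun x => hmul (iter k.*2 shift x)
     (\big[hmul/ones]_(1 <= j < k.+1) (ones + iter (j.*2).-1 shift x))].

Lemma gamma0 : gamma 0 = idfun_ff n.
Proof.
apply/ffunP=> x; rewrite !ffunE big_geq //=.
by apply/matrixP=> i j; rewrite !mxE mulr1.
Qed.

Definition Gn (f : vecfun n) : Prop :=
  f - gamma 0 \in <<[seq gamma k | k <- iota 1 n.-1]>>%VS.

(* The library replaces a modulus that is not monic of positive degree by 'X;
   see [mk_monic_modulus]. *)
Definition modulus : {poly 'F_2} := 'X^n + 'X^(n./2).

Lemma mk_monic_modulus : (0 < n)%N -> mk_monic modulus = modulus.
Proof.
move=> n_gt0; have n2: (n./2 < n)%N by rewrite ltn_half_double -addnn -ltn_subLR ?subnn.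
have sz: (size ('X^(n./2) : {poly 'F_2}) < size ('X^n : {poly 'F_2}))%N.
  by rewrite !size_polyXn ltnS.
rewrite /mk_monic /modulus size_polyDl // size_polyXn ltnS n_gt0 /=.
by rewrite monicE lead_coefDl // lead_coefXn eqxx.
Qed.

Notation Rn := {poly %/ modulus}.

Definition Mn (r : Rn) : Prop :=
  exists (t : nat) (a : nat -> 'F_2), (1 <= t)%N /\
    r = in_qpoly modulus (1 + \sum_(1 <= i < t.+1) a i *: 'X^i).

Definition Gstar : vecfun n -> Prop := invertible Gn (@comp_ff n) (idfun_ff n).
Definition Mstar : Rn -> Prop := invertible Mn *%R 1.
Definition Rstar : Rn -> Prop := fun r => r \is a GRing.unit.

End Gamma.

Notation Rn n := {poly %/ modulus n}.

(* Main.v *)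
Require Import Defs.
From HB Require Import structures.
From mathcomp Require Import all_boot all_order all_algebra all_fingroup.

Set Implicit Arguments.
Unset Strict Implicit.
Unset Printing Implicit Defensive.

Import GRing.Theory.
Local Open Scope ring_scope.

(* Composition with a fixed function is linear on the outer factor, so everything
   reduces to gamma_{2k} o g for g = sum_j b_j gamma_{2j} with b_0 = 1. From
   gamma_{2k+2}(x) = S^2(gamma_{2k}(x)) * (1 + S(x)) and the orthogonality
   S(gamma_{2i}(x)) * gamma_{2j}(x) = 0 for j >= 1, induction on k gives
   gamma_{2k} o g = sum_j b_j gamma_{2(k+j)}, the counterpart of multiplication
   by X^k. For even n, the coordinates at odd distance from a given one are
   exhausted after n/2 factors, whence gamma_{2n} = gamma_n and the modulus
   X^n + X^(n/2). *)

(** * Arithmetic in F_2 and the coordinates of gamma_{2k} *)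

Lemma F2_mulC1 (a : 'F_2) : a * (1 + a) = 0.
Proof. by case: a => -[|[|]] // ?; apply/eqP. Qed.

Lemma F2_mulrr (a : 'F_2) : a * a = a.
Proof. by case: a => -[|[|]] // ?; apply/eqP. Qed.

Lemma F2_addrr (a : 'F_2) : a + a = 0.
Proof. by case: a => -[|[|]] // ?; apply/eqP. Qed.

Lemma F2_eq1 (a : 'F_2) : a != 0 -> a = 1.
Proof. by case: a => -[|[|]] // ? _; apply/eqP. Qed.

Lemma iter_shiftE n k (x : vec n) i :
  iter k (@shift n) x ord0 i = x ord0 (iter k (@ordS n) i).
Proof. by elim: k i => //= k IHk i; rewrite mxE IHk -iterSr. Qed.

Lemma gammaE n k (x : vec n) i :
  gamma n k x ord0 i = x ord0 (iter k.*2 (@ordS n) i) *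
    \prod_(1 <= j < k.+1) (1 + x ord0 (iter (j.*2).-1 (@ordS n) i)).
Proof.
rewrite ffunE mxE iter_shiftE; congr (_ * _).
rewrite (big_morph (fun y : vec n => y ord0 i) (op1 := *%R) (id1 := 1)).
- by apply: eq_bigr => j _; rewrite !mxE iter_shiftE.
- by move=> y z; rewrite mxE.
- by rewrite mxE.
Qed.

Lemma gamma0E n (x : vec n) : gamma n 0 x = x.
Proof. by rewrite gamma0 ffunE. Qed.

(** The factor j = 1 is split off; the leading entry and the other factors are those of [gamma n k]
    read two positions further on. *)
Lemma gammaSE n k (x : vec n) i :
  gamma n k.+1 x ord0 i =
    gamma n k x ord0 (ordS (ordS i)) * (1 + x ord0 (ordS i)).
Proof.
rewrite !gammaE doubleS !iterSr -mulrA; congr (_ * _).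
rewrite big_nat_recl //= mulrC; congr (_ * _).
by apply: eq_big_nat => -[//|j] _; rewrite !doubleS /= -!iterSr.
Qed.

(** Peeling a factor off both sides lowers both indices by one and moves two positions on. Whichever
    index reaches 0 first leaves a bare entry y beside a factor 1 + y. *)
Lemma gamma_orthogonal n a b (x : vec n) i :
  gamma n a x ord0 (ordS i) * gamma n b.+1 x ord0 i = 0.
Proof.
elim: a b i => [|a IHa] b i; rewrite gammaSE.
  by rewrite gamma0E mulrCA F2_mulC1 mulr0.
rewrite gammaSE mulrACA; case: b => [|b]; last by rewrite IHa mul0r.
by rewrite gamma0E -mulrA (mulrA (x _ _)) F2_mulC1 mul0r mulr0.
Qed.

Lemma iter_ordS_val n k (i : 'I_n) : iter k (@ordS n) i = ((i + k) %% n)%N :> nat.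
Proof.
elim: k => [|k IHk] /=; first by rewrite addn0 modn_small.
by rewrite IHk -addn1 modnDml -addnA addn1.
Qed.

Lemma iter_ordS_modn n k l (i : 'I_n) :
  k = l %[mod n] -> iter k (@ordS n) i = iter l (@ordS n) i.
Proof.
by move=> kl; apply/val_inj; rewrite /= !iter_ordS_val -modnDmr kl modnDmr.
Qed.

Lemma gamma_cycle n k : ~~ odd n -> gamma n (k + n) = gamma n (k + n./2).
Proof.
move=> n_even; have nE : n = n./2.*2 by rewrite even_halfK.
have iterD l i : iter (l + n) (@ordS n) i = iter l (@ordS n) i.
  by apply: iter_ordS_modn; rewrite modnDr.
elim: k => [|k IHk]; apply/ffunP => x; apply/rowP => i; last first.
  by rewrite !addSn !gammaSE IHk.
rewrite !add0n !gammaE -nE -addnn iterD; congr (_ * _).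
(* Factors j and j + n/2 read positions n apart, hence the same entry; the two halves of the product
   agree and merge by idempotence. *)
rewrite (big_cat_nat _ (n := n./2.+1)) //=; last first.
  by rewrite ltnS [X in (_ <= X)%N]nE -addnn leq_addr.
rewrite -(add1n n./2) (big_addn 1 n.+1 n./2) add1n.
have -> : (n.+1 - n./2 = n./2.+1)%N by rewrite [X in X.+1]nE -addnn -addSn addnK.
rewrite -big_split /=; apply: eq_big_nat => -[//|j] _.
by rewrite doubleD -nE doubleS addSn [_.-1]/= iterD F2_mulrr.
Qed.

(** * Linear extension of X^k -> gamma_{2k} to all polynomials *)

(** The inverse of φ, before passing to the quotient: products can be formed here without any
    reduction. *)
Definition poly_gamma n (p : {poly 'F_2}) : vecfun n :=
  \sum_(i < size p) p`_i *: gamma n i.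

(** Provides a common summation range for polynomials of different sizes, as linearity requires. *)
Lemma poly_gamma_widen n m (p : {poly 'F_2}) :
  (size p <= m)%N -> poly_gamma n p = \sum_(i < m) p`_i *: gamma n i.
Proof.
move=> le_pm; rewrite /poly_gamma (big_ord_widen m (fun i => p`_i *: gamma n i)) //.
rewrite big_mkcond /=; apply: eq_bigr => i _; case: ltnP => // ?.
by rewrite nth_default ?scale0r.
Qed.

Lemma poly_gamma_is_linear n : linear (poly_gamma n).
Proof.
move=> c p q; pose m := maxn (size (c *: p + q)) (maxn (size p) (size q)).
rewrite !(@poly_gamma_widen n m) ?leq_max ?leqnn ?orbT // scaler_sumr -big_split /=.
by apply: eq_bigr => i _; rewrite coefD coefZ scalerDl scalerA.
Qed.

HB.instance Definition _ n := GRing.isLinear.Build 'F_2 {poly 'F_2} (vecfun n)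
  *:%R (poly_gamma n) (@poly_gamma_is_linear n).

Lemma poly_gammaXn n k : poly_gamma n 'X^k = gamma n k.
Proof.
rewrite /poly_gamma size_polyXn big_ord_recr /= big1 ?add0r.
  by rewrite coefXn eqxx scale1r.
by move=> i _; rewrite coefXn (ltn_eqF (ltn_ord i)) scale0r.
Qed.

(** * Composition as multiplication of polynomials *)

Lemma comp_poly_gammal n p (f : vecfun n) :
  comp_ff (poly_gamma n p) f = \sum_(i < size p) p`_i *: comp_ff (gamma n i) f.
Proof.
apply/ffunP => x; rewrite ffunE !sum_ffunE; apply: eq_bigr => i _.
by rewrite !ffunE.
Qed.

Lemma poly_gamma_coordE n (p : {poly 'F_2}) (x : vec n) i :
  poly_gamma n p x ord0 i = \sum_(j < size p) p`_j * gamma n j x ord0 i.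
Proof. by rewrite sum_ffunE summxE; apply: eq_bigr => j _; rewrite !ffunE !mxE. Qed.

Lemma poly_gammaMX_coordE n (p : {poly 'F_2}) (x : vec n) i :
  poly_gamma n ('X * p) x ord0 i =
    \sum_(j < size p) p`_j * gamma n j.+1 x ord0 i.
Proof.
have szp : (size ('X * p)%R <= (size p).+1)%N.
  by rewrite (leq_trans (size_polyMleq _ _)) // size_polyX.
rewrite (poly_gamma_widen _ szp) big_ord_recl coefXM scale0r add0r.
rewrite sum_ffunE summxE; apply: eq_bigr => j _.
by rewrite [in LHS]ffunE mxE coefXM.
Qed.

Lemma poly_gammaMXE n (p : {poly 'F_2}) (x : vec n) i :
  poly_gamma n ('X * p) x ord0 i =
    poly_gamma n p x ord0 (ordS (ordS i)) * (1 + x ord0 (ordS i)).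
Proof.
rewrite poly_gammaMX_coordE poly_gamma_coordE mulr_suml.
by apply: eq_bigr => j _; rewrite gammaSE mulrA.
Qed.

Lemma poly_gamma_orthogonal n (p q : {poly 'F_2}) (x : vec n) i :
  poly_gamma n p x ord0 (ordS i) * poly_gamma n ('X * q) x ord0 i = 0.
Proof.
rewrite poly_gammaMX_coordE poly_gamma_coordE mulr_sumr big1 // => b _.
by rewrite mulr_suml big1 // => a _; rewrite mulrACA gamma_orthogonal mulr0.
Qed.

(** Writing q = 1 + X r isolates the part X r to which orthogonality applies. *)
Lemma poly_gamma_coef0 n (q : {poly 'F_2}) (x : vec n) : q`_0 = 1 ->
  exists r, forall i,
    poly_gamma n q x ord0 i = x ord0 i + poly_gamma n ('X * r) x ord0 i.
Proof.
elim/poly_ind: q => [|r c _]; first by rewrite coef0 => /eqP; rewrite eq_sym oner_eq0.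
rewrite coefD coefMX coefC /= add0r => ->; exists r => i.
rewrite mulrC addrC linearD /= polyC1 -(expr0 'X) poly_gammaXn ffunE.
by rewrite gamma0E mxE.
Qed.

Lemma comp_gamma_poly n k (q : {poly 'F_2}) : q`_0 = 1 ->
  comp_ff (gamma n k) (poly_gamma n q) = poly_gamma n ('X^k * q).
Proof.
move=> q0; elim: k => [|k IHk].
  by apply/ffunP => x; rewrite ffunE gamma0E mul1r.
apply/ffunP => x; apply/rowP => i; rewrite ffunE gammaSE.
have [r qE] := poly_gamma_coef0 x q0.
have := congr1 (fun f : vecfun n => f x) IHk; rewrite ffunE => ->.
(* With g the function of q, the surplus of 1 + g(x)_{i+1} over 1 + x_{i+1} comes from X r and is
   killed by coordinate i+2 of the function of X^k q. The recursion for multiplication by X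
   remains. *)
by rewrite qE addrA mulrDr poly_gamma_orthogonal addr0 exprS -mulrA poly_gammaMXE.
Qed.

Lemma comp_poly_gamma n (p q : {poly 'F_2}) : q`_0 = 1 ->
  comp_ff (poly_gamma n p) (poly_gamma n q) = poly_gamma n (p * q).
Proof.
move=> q0; rewrite comp_poly_gammal -[p in RHS]coefK poly_def mulr_suml linear_sum.
by apply: eq_bigr => i _; rewrite comp_gamma_poly // -scalerAl linearZ.
Qed.

(** * Reduction modulo X^n + X^(n/2) *)

Lemma poly_gammaM_modulus n (p : {poly 'F_2}) : ~~ odd n ->
  poly_gamma n (p * modulus n) = 0.
Proof.
move=> n_even; rewrite -[p]coefK poly_def mulr_suml linear_sum big1 // => i _.
rewrite -scalerAl linearZ /= mulrDr -!exprD linearD /= !poly_gammaXn.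
by rewrite gamma_cycle // -[gamma _ _]scale1r -scalerDl F2_addrr scale0r scaler0.
Qed.

Lemma in_qpoly_divE n (p : {poly 'F_2}) : (0 < n)%N ->
  exists c, p = c * modulus n + in_qpoly (modulus n) p.
Proof.
move=> n_gt0; exists (Pdiv.CommonRing.rdivp p (modulus n)).
have mon : modulus n \is monic by rewrite -(mk_monic_modulus n_gt0) monic_mk_monic.
by rewrite /= (mk_monic_modulus n_gt0); apply: Pdiv.RingMonic.rdivp_eq.
Qed.

Lemma poly_gamma_in_qpoly n (p : {poly 'F_2}) : (0 < n)%N -> ~~ odd n ->
  poly_gamma n (in_qpoly (modulus n) p) = poly_gamma n p.
Proof.
move=> n_gt0 n_even; have [c {2}->] := in_qpoly_divE p n_gt0.
by rewrite linearD /= poly_gammaM_modulus // add0r.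
Qed.

(** For n >= 2 both exponents n and n/2 are positive, so multiples of the modulus have constant
    coefficient 0. *)
Lemma in_qpoly_coef0 n (p : {poly 'F_2}) : (2 <= n)%N ->
  (in_qpoly (modulus n) p)`_0 = p`_0.
Proof.
move=> n_ge2; have [c {2}->] := in_qpoly_divE p (ltnW n_ge2).
rewrite coefD coef0M coefD !coefXn.
by case: n n_ge2 => [|[|n]] //= _; rewrite addr0 mulr0 add0r.
Qed.

(** * Linear independence of gamma_0, ..., gamma_{2n-2} by test vectors *)

Lemma gamma_row0E n k (f : nat -> 'F_2) (n_gt0 : (0 < n)%N) :
  gamma n k (\row_i f i) ord0 (Ordinal n_gt0) =
    f (k.*2 %% n)%N * \prod_(1 <= j < k.+1) (1 + f ((j.*2).-1 %% n)%N).
Proof.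
rewrite gammaE mxE iter_ordS_val; congr (_ * _).
by apply: eq_bigr => j _; rewrite mxE iter_ordS_val.
Qed.

(* On these vectors the factor 1 + x_{n-1} kills every gamma_{2l} with l >= n/2;
   dropping the entry at n-1 in gamma_separate_high then detects the others. *)
Lemma gamma_separate_low n (n_gt0 : (0 < n)%N) (n_even : ~~ odd n) k l :
  (k < n./2)%N -> (l < n)%N ->
  gamma n l (\row_i ((i == k.*2 :> nat) || (i == n.-1 :> nat))%:R) ord0
    (Ordinal n_gt0) = (l == k)%:R.
Proof.
move=> kn ln; have nE : n = n./2.*2 by rewrite even_halfK.
have oddn1 : odd n.-1 by move: n_gt0 n_even; case: (n) => //= m _; rewrite negbK.
have dE j : (j.*2 == n.-1) = false.
  by apply/eqP => jn; move: oddn1; rewrite -jn odd_double.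
pose f j : 'F_2 := ((j == k.*2) || (j == n.-1))%:R.
rewrite (gamma_row0E l f n_gt0) {}/f; case: (ltnP l n./2) => ln2.
  have l2n : (l.*2 < n)%N by rewrite [X in (_ < X)%N]nE ltn_double.
  (* For l < n/2 the factors read odd positions below n-1, where the vector vanishes. *)
  rewrite modn_small // dE orbF (inj_eq double_inj) big_nat big1 ?mulr1 //.
  case=> // j; rewrite /= ltnS => jl.
  have j2l : (j.*2.+2 <= l.*2)%N by rewrite -doubleS leq_double.
  have j2n : (j.*2.+2 < n)%N by apply: leq_ltn_trans l2n.
  rewrite modn_small; last exact: ltnW.
  case: eqP => [jk | _] /=; first by have := odd_double k; rewrite -jk /= odd_double.
  by rewrite (_ : (_ == _) = false) ?addr0 // ltn_eqF // -ltnS prednK.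
rewrite (_ : (l == k) = false); last by rewrite gtn_eqF // (leq_trans kn).
have m_gt0 : (0 < n./2)%N by apply: leq_ltn_trans kn.
rewrite (big_cat_nat _ (n := n./2)) //=; last exact: leqW.
rewrite [X in _ * (_ * X)]big_ltn // -nE (modn_small (_ : n.-1 < n)%N) ?prednK // eqxx orbT F2_addrr.
by rewrite mul0r !mulr0.
Qed.

(** Every factor is 1, because 2j-1 stays odd modulo the even n and the support is one even
    position. The leading entry sees l only modulo n/2. *)
Lemma gamma_separate_high n (n_gt0 : (0 < n)%N) (n_even : ~~ odd n) k l :
  (k < n./2)%N ->
  gamma n l (\row_i (i == k.*2 :> nat)%:R) ord0 (Ordinal n_gt0)
    = (l == k %[mod n./2])%:R.
Proof.
move=> kn; have nE : n = n./2.*2 by rewrite even_halfK.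
rewrite (gamma_row0E l (fun j => (j == k.*2)%:R) n_gt0).
have -> : (l.*2 %% n = (l %% n./2).*2)%N by rewrite {1}nE -!muln2 muln_modl.
rewrite (inj_eq double_inj) [in RHS](modn_small kn) big_nat big1 ?mulr1 //.
case=> // j _; rewrite (_ : (_ == _) = false) ?addr0 //.
apply/eqP => /(congr1 odd); rewrite odd_double doubleS /=.
have /(congr1 odd) := divn_eq j.*2.+1 n.
by rewrite oddD oddM (negbTE n_even) andbF /= odd_double => <-.
Qed.

(** Elimination in two rounds: the first test vectors isolate each coefficient below n/2; the second
    see the sum of the coefficients at k - n/2 and k, the former being already 0. *)
Lemma poly_gamma_inj0 n (p : {poly 'F_2}) : (0 < n)%N -> ~~ odd n ->
  (size p <= n)%N -> poly_gamma n p = 0 -> p = 0.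
Proof.
move=> n_gt0 n_even szp p0; have nE : n = n./2.*2 by rewrite even_halfK.
have p0E x : \sum_(i < n) p`_i * gamma n i x ord0 (Ordinal n_gt0) = 0.
  have := congr1 (fun f : vecfun n => f x ord0 (Ordinal n_gt0)) p0.
  rewrite (poly_gamma_widen _ szp) sum_ffunE summxE ffunE mxE => p0x; rewrite -[RHS]p0x.
  by apply: eq_bigr => i _; rewrite [in RHS]ffunE mxE.
have low k : (k < n./2)%N -> p`_k = 0.
  move=> kn; have kn' : (k < n)%N by rewrite (leq_trans kn) // [X in (_ <= X)%N]nE -addnn leq_addr.
  have := p0E (\row_i ((i == k.*2 :> nat) || (i == n.-1 :> nat))%:R).
  rewrite (bigD1 (Ordinal kn')) //= gamma_separate_low // eqxx mulr1.
  rewrite big1 ?addr0 // => i ik; rewrite gamma_separate_low //.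
  by rewrite (negbTE (_ : (i : nat) != k)) ?mulr0.
apply/polyP => k; rewrite coef0; case: (ltnP k n./2) => [/low // | nk].
case: (ltnP k n) => kn; last by rewrite nth_default // (leq_trans szp).
have kn2 : (k - n./2 < n./2)%N by rewrite ltn_subLR // addnn -nE.
have := p0E (\row_i (i == (k - n./2).*2 :> nat)%:R).
rewrite (bigD1 (Ordinal kn)) //= gamma_separate_high //.
have modE j : (n./2 <= j)%N -> j = j - n./2 %[mod n./2].
  by move=> nj; rewrite -{1}(subnK nj) modnDr.
rewrite modE // eqxx mulr1 big1 ?addr0 // => i ik.
rewrite gamma_separate_high //; case: (ltnP i n./2) => [/low -> | ni].
  by rewrite mul0r.
have in2 : (i - n./2 < n./2)%N by rewrite ltn_subLR // addnn -nE.
rewrite modE // !modn_small // (negbTE (_ : _ != _)) ?mulr0 //.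
apply: contra ik => /eqP ik; apply/eqP/val_inj => /=.
by rewrite -(subnK ni) ik subnK.
Qed.

(** * Canonical representatives; M_n and G_n described by the constant coefficient *)

Lemma size_Rn n (r : Rn n) : (0 < n)%N -> (size r <= n)%N.
Proof.
move=> n_gt0; rewrite -ltnS (leq_trans (size_mk_monic r)) // mk_monic_modulus //.
rewrite (leq_trans (size_polyD _ _)) // !size_polyXn geq_max leqnn ltnS.
by rewrite leq_half_double -addnn leqW ?leq_addr.
Qed.

Lemma in_qpolyK n (r : Rn n) : in_qpoly (modulus n) r = r.
Proof. by apply/val_inj/in_qpoly_small/size_mk_monic. Qed.

(** The difference of the reduced representatives has size at most n and still maps to 0, so linear
    independence applies. *)
Lemma eq_poly_gamma n (p q : {poly 'F_2}) : (0 < n)%N -> ~~ odd n ->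
  poly_gamma n p = poly_gamma n q ->
  in_qpoly (modulus n) p = in_qpoly (modulus n) q.
Proof.
move=> n_gt0 n_even pq; apply/eqP; rewrite -subr_eq0; apply/eqP/val_inj.
apply: (@poly_gamma_inj0 n) => //; first exact: size_Rn.
by rewrite -linearB poly_gamma_in_qpoly // linearB /= pq subrr.
Qed.

Lemma MnP n (r : Rn n) : (2 <= n)%N -> Mn r <-> r`_0 = 1.
Proof.
move=> n_ge2; split=> [[t [a [t_ge1 ->]]] | r0].
  rewrite in_qpoly_coef0 // coefD coef1 coef_sum big_nat big1 ?addr0 //.
  by case=> // i _; rewrite coefZ coefXn mulr0.
(* The bound t = n covers every index of the canonical representative; the coefficient at n itself
   is 0 by default. *)
exists n, (fun i => r`_i); split; first exact: ltnW.
rewrite -[LHS]in_qpolyK; congr in_qpoly; apply/polyP => k.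
rewrite coefD coef1 coef_sum; under eq_bigr do rewrite coefZ coefXn.
case: k => [|k].
  rewrite r0 big_nat big1 ?addr0 // => -[] // i _; exact: mulr0.
case: (leqP k.+1 n) => kn; last first.
  rewrite nth_default; last by rewrite (leq_trans (size_Rn _ (ltnW n_ge2))) // ltnW.
  rewrite add0r big_nat big1 // => i /andP[_ /leq_trans le_in].
  by rewrite gtn_eqF ?mulr0 // le_in.
rewrite add0r (bigD1_seq k.+1) ?iota_uniq //=; last by rewrite mem_index_iota ltnS.
rewrite eqxx mulr1 big1 ?addr0 // => i ik.
by rewrite eq_sym (negbTE ik) mulr0.
Qed.

Lemma Mn_in_qpoly n (p : {poly 'F_2}) : (2 <= n)%N -> p`_0 = 1 ->
  Mn (in_qpoly (modulus n) p).
Proof. by move=> n_ge2 p0; apply/MnP; rewrite ?in_qpoly_coef0. Qed.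

Lemma GnP n (f : vecfun n) : (2 <= n)%N -> ~~ odd n ->
  Gn f <-> exists2 p : {poly 'F_2}, p`_0 = 1 & f = poly_gamma n p.
Proof.
move=> n_ge2 n_even; split=> [|[p p0 ->]]; rewrite /Gn.
  rewrite -[[seq _ | _ <- _]]/(tval (in_tuple _)) => /coord_span fE.
  set c := coord _ in fE.
  (* The generators start at [gamma n 1], so coordinate i belongs to X^(i+1). *)
  exists (1 + \sum_i c i (f - gamma n 0) *: 'X^(i.+1)).
    rewrite coefD coef1 coef_sum big1 ?addr0 // => i _.
    by rewrite coefZ coefXn mulr0.
  rewrite linearD -(expr0 'X) /= poly_gammaXn linear_sum /=.
  apply/eqP; rewrite addrC -subr_eq [X in X == _]fE; apply/eqP/eq_bigr => i _.
  rewrite linearZ /= poly_gammaXn (nth_map 0%N) ?nth_iota ?add1n //.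
    by rewrite (leq_trans (ltn_ord i)) // size_map size_iota.
  by rewrite (leq_trans (ltn_ord i)) // size_map.
(* Reducing p keeps its function and constant coefficient, and leaves only the indices below n that
   the span allows. *)
rewrite -poly_gamma_in_qpoly ?(ltnW n_ge2) //.
set r := in_qpoly _ p; have r0 : r`_0 = 1 by rewrite in_qpoly_coef0.
have szr : (size r <= n.-1.+1)%N by rewrite prednK ?size_Rn // ltnW.
rewrite (poly_gamma_widen _ szr) big_ord_recl r0 scale1r [_ - _]addrC addKr.
apply: memv_suml => i _; apply/memvZ/memv_span/map_f.
by rewrite mem_iota add1n ltnS ltn_ord.
Qed.

(** * The isomorphism φ *)

(** φ as a total map: the finite ring R_n is searched for a preimage under [poly_gamma], with value
    0 outside Γ_n. *)
Definition gamma_poly n (f : vecfun n) : Rn n :=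
  odflt 0 [pick r : Rn n | poly_gamma n r == f].

Lemma poly_gammaK n (p : {poly 'F_2}) : (0 < n)%N -> ~~ odd n ->
  gamma_poly (poly_gamma n p) = in_qpoly (modulus n) p.
Proof.
move=> n_gt0 n_even; rewrite /gamma_poly; case: pickP => [r /eqP rp | /(_ (in_qpoly _ p))].
  by rewrite /= -[r]in_qpolyK; apply: eq_poly_gamma.
by rewrite poly_gamma_in_qpoly ?eqxx.
Qed.

Lemma idfun_poly_gamma n : idfun_ff n = poly_gamma n 1.
Proof. by rewrite -gamma0 -poly_gammaXn expr0. Qed.

Lemma comp_ffA n (f g h : vecfun n) :
  comp_ff f (comp_ff g h) = comp_ff (comp_ff f g) h.
Proof. by apply/ffunP => x; rewrite !ffunE. Qed.

Lemma comp_ff1f n (f : vecfun n) : comp_ff (idfun_ff n) f = f.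
Proof. by apply/ffunP => x; rewrite !ffunE. Qed.

Lemma comp_fff1 n (f : vecfun n) : comp_ff f (idfun_ff n) = f.
Proof. by apply/ffunP => x; rewrite !ffunE. Qed.

Lemma Gn_abelian_monoid n : (2 <= n)%N -> ~~ odd n ->
  abelian_monoid (@Gn n) (@comp_ff n) (idfun_ff n).
Proof.
move=> n_ge2 n_even; have GP f := GnP f n_ge2 n_even; split.
- by apply/GP; exists 1; rewrite ?coef1 ?idfun_poly_gamma.
- move=> _ _ /GP[p p0 ->] /GP[q q0 ->]; apply/GP; exists (p * q).
    by rewrite coef0M p0 q0 mulr1.
  exact: comp_poly_gamma.
- by move=> *; apply: comp_ffA.
- by move=> *; apply: comp_ff1f.
- by move=> *; apply: comp_fff1.
- by move=> _ _ /GP[p p0 ->] /GP[q q0 ->]; rewrite !comp_poly_gamma // mulrC.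
Qed.

Lemma Rn_coef0M n (r s : Rn n) : (2 <= n)%N -> (r * s)`_0 = r`_0 * s`_0.
Proof.
by move=> n_ge2; rewrite -[r]in_qpolyK -[s]in_qpolyK -in_qpolyM !in_qpoly_coef0 // coef0M.
Qed.

Lemma Mn_abelian_monoid n : (2 <= n)%N ->
  abelian_monoid (@Mn n) *%R 1.
Proof.
move=> n_ge2; have MP r := MnP r n_ge2; split.
- by apply/MP; rewrite -in_qpoly1 in_qpoly_coef0 ?coef1.
- by move=> r s /MP r0 /MP s0; apply/MP; rewrite Rn_coef0M // r0 s0 mulr1.
- by move=> *; apply: mulrA.
- by move=> *; apply: mul1r.
- by move=> *; apply: mulr1.
- by move=> *; apply: mulrC.
Qed.

Lemma gamma_poly_iso n : (2 <= n)%N -> ~~ odd n ->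
  monoid_iso (@Gn n) (@comp_ff n) (idfun_ff n) (@Mn n) *%R 1 (@gamma_poly n).
Proof.
move=> n_ge2 n_even; have n_gt0 := ltnW n_ge2.
have GP f := GnP f n_ge2 n_even; split.
- by move=> _ /GP[p p0 ->]; rewrite poly_gammaK //; apply: Mn_in_qpoly.
- move=> _ _ /GP[p p0 ->] /GP[q q0 ->]; rewrite !poly_gammaK // => pq.
  by rewrite -poly_gamma_in_qpoly // pq poly_gamma_in_qpoly.
- move=> r /MnP -/(_ n_ge2) r0; exists (poly_gamma n r).
    by apply/GP; exists r.
  by rewrite poly_gammaK // in_qpolyK.
- by rewrite idfun_poly_gamma poly_gammaK // in_qpoly1.
- move=> _ _ /GP[p p0 ->] /GP[q q0 ->].
  by rewrite comp_poly_gamma // !poly_gammaK // in_qpolyM.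
Qed.

(** * Invertible elements *)

Lemma invertible_abelian_group (T : Type) (A : T -> Prop) op e :
  abelian_monoid A op e -> abelian_group (invertible A op e) op e.
Proof.
move=> [A1 AM AA A1l A1r AC]; have inv1 : invertible A op e e.
  by split=> //; exists e; rewrite A1l.
split; last first.
  move=> x [Ax [y [Ay xy yx]]]; split; first by split=> //; exists y.
  by exists y; split=> //; split=> //; exists x.
split=> //; try by move=> x [Ax _]; auto.
- move=> x y [Ax [x' [Ax' xx' x'x]]] [Ay [y' [Ay' yy' y'y]]].
  split; first exact: AM.
  exists (op y' x'); split; first exact: AM.
    rewrite -AA //; last exact: AM.
    by rewrite [op y (op _ _)]AA // yy' A1l.
  rewrite -AA //; last exact: AM.
  by rewrite [op x' (op _ _)]AA // x'x A1l.
- by move=> x y z [Ax _] [Ay _] [Az _]; apply: AA.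
- by move=> x y [Ax _] [Ay _]; apply: AC.
Qed.

(** By injectivity, preimages of mutually inverse elements are mutually inverse, so surjectivity
    survives the restriction. *)
Lemma monoid_iso_invertible (T U : Type) (A : T -> Prop) opA eA
    (B : U -> Prop) opB eB (f : T -> U) :
  A eA -> (forall x y, A x -> A y -> A (opA x y)) ->
  monoid_iso A opA eA B opB eB f ->
  monoid_iso (invertible A opA eA) opA eA (invertible B opB eB) opB eB f.
Proof.
move=> A1 AM [finto finj fsurj f1 fM]; split=> //.
- move=> x [Ax [y [Ay xy yx]]]; split; first exact: finto.
  by exists (f y); rewrite -!fM // xy yx f1; split=> //; apply: finto.
- by move=> x y [Ax _] [Ay _]; apply: finj.
- move=> z [Bz [w [Bw zw wz]]].
  have [x Ax fx] := fsurj z Bz; have [y Ay fy] := fsurj w Bw.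
  exists x => //; split=> //; exists y; split=> //.
    by apply: finj; rewrite ?fM ?fx ?fy ?zw ?f1 //; apply: AM.
  by apply: finj; rewrite ?fM ?fx ?fy ?wz ?f1 //; apply: AM.
- by move=> x y [Ax _] [Ay _]; apply: fM.
Qed.

(** The constant coefficients of a unit and its inverse multiply to 1, hence both equal 1 in F_2,
    and both elements lie in M_n. *)
Lemma RstarP n (r : Rn n) : (2 <= n)%N -> Rstar r <-> Mstar r.
Proof.
move=> n_ge2; rewrite /Rstar /Mstar; split=> [/unitrP[s [sr rs]] | [_ [s [_ rs sr]]]].
  have : r`_0 * s`_0 = 1.
    by rewrite -Rn_coef0M // rs -in_qpoly1 in_qpoly_coef0 ?coef1.
  move=> rs0; split.
    apply/MnP => //; apply: F2_eq1; apply: contra_eq_neq rs0 => ->.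
    by rewrite mul0r eq_sym oner_eq0.
  exists s; split=> //; apply/MnP => //; apply: F2_eq1.
  by apply: contra_eq_neq rs0 => ->; rewrite mulr0 eq_sym oner_eq0.
by apply/unitrP; exists s.
Qed.

(* A bijection of a finite set is inverted by one of its own powers, and the
   powers of f stay in G_n. *)
Lemma GstarP n (f : vecfun n) : (2 <= n)%N -> ~~ odd n -> Gn f ->
  Gstar f <-> bijective f.
Proof.
move=> n_ge2 n_even Gf; split=> [[_ [g [_ fg gf]]] | /bij_inj f_inj].
  by exists g => x; [have := congr1 (fun h : vecfun n => h x) gf
    | have := congr1 (fun h : vecfun n => h x) fg]; rewrite !ffunE.
have [G1 GM _ _ _ _] := Gn_abelian_monoid n_ge2 n_even.
have Giter k : Gn [ffun x => iter k f x].
  elim: k => [//|k IHk]; have := GM _ _ Gf IHk; congr Gn.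
  by apply/ffunP => x; rewrite !ffunE.
pose s := perm f_inj; split=> //; exists [ffun x => iter #[s]%g.-1 f x].
have iterE x : iter #[s]%g f x = x.
  rewrite -[RHS](perm1 x) -(expg_order s) permX.
  by apply: eq_iter => y; rewrite permE.
have sE : #[s]%g = #[s]%g.-1.+1 by rewrite prednK ?order_gt0.
split=> //; apply/ffunP => x; rewrite !ffunE -?iterS -?iterSr -sE; exact: iterE.
Qed.

Theorem theorem8 (n : nat) (n_ge2 : (2 <= n)%N) (n_even : ~~ odd n) :
  (* (a) *)
  [/\ abelian_monoid (@Gn n) (@comp_ff n) (idfun_ff n),
      abelian_monoid (@Mn n) *%R 1,
      exists phi : vecfun n -> Rn n,
        (forall (t : nat) (a : nat -> 'F_2),
           phi (\sum_(0 <= i < t.+1) a i *: gamma n i)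
           = in_qpoly (modulus n) (\sum_(0 <= i < t.+1) a i *: 'X^i))
        /\ monoid_iso (@Gn n) (@comp_ff n) (idfun_ff n) (@Mn n) *%R 1 phi &
      monoid_isomorphic (@Gn n) (@comp_ff n) (idfun_ff n) (@Mn n) *%R 1]
  /\
  (* (b) *)
  [/\ forall f : vecfun n, Gn f -> (Gstar f <-> bijective f),
      abelian_group (@Gstar n) (@comp_ff n) (idfun_ff n),
      forall r : Rn n, Rstar r <-> Mstar r &
      monoid_isomorphic (@Gstar n) (@comp_ff n) (idfun_ff n) (@Rstar n) *%R 1].
Proof.
have GM := Gn_abelian_monoid n_ge2 n_even; have iso := gamma_poly_iso n_ge2 n_even.
split; split.
- exact: GM.
- exact: Mn_abelian_monoid.
- exists (@gamma_poly n); split=> // t a; rewrite -poly_gammaK ?(ltnW n_ge2) //.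
  congr gamma_poly; rewrite linear_sum; apply: eq_bigr => i _.
  by rewrite linearZ /= poly_gammaXn.
- by exists (@gamma_poly n).
- by move=> f; apply: GstarP.
- exact: invertible_abelian_group.
- by move=> r; apply: RstarP.
- exists (@gamma_poly n).
  have [G1 Gmul _ _ _ _] := GM.
  (* φ restricts to an isomorphism onto M_n^*, which [RstarP] then replaces by R_n^*. *)
  have [finto finj fsurj f1 fM] := monoid_iso_invertible G1 Gmul iso; split=> //.
    by move=> f /finto /RstarP -/(_ n_ge2).
  by move=> r /RstarP -/(_ n_ge2)/fsurj.
Qed.
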